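(* Let $d\in\mathbb{N}$ and let $U$ be a bounded open set in $\mathbb{R}^{d}$, with complement $U^c=\mathbb{R}^d\setminus U$. Then the Lipschitz free space $\mathcal{F}(\mathbb{R}^{d}/U^{c})$ is linearly isometric to the Sobolev space $W^{-1,1}(U)$.
   Context: For a pointed metric space $\mathcal{M}$, $\mathcal{F}(\mathcal{M})$ is the Lipschitz free (Banach) space: the Banach space, unique up to linear isometry, with an isometric embedding $\delta_{\mathcal{M}}\colon\mathcal{M}\to\mathcal{F}(\mathcal{M})$, $\delta_{\mathcal{M}}(0)=0$, such that every Lipschitz map $f$ from $\mathcal{M}$ to a Banach space $X$ with $f(0)=0$ factors as $f=T_f\circ\delta_{\mathcal{M}}$ for a unique bounded linear $T_f\colon\mathcal{F}(\mathcal{M})\to X$, and $\|T_f\|=\mathrm{Lip}(f)$. Scalars are real. For a metric space $(\mathcal{M},\rho)$ with base point $0$ and a closed set $\mathcal{N}\subset\mathcal{M}$ with $0\in\mathcal{N}$, the quotient $\mathcal{M}/\mathcal{N}$ is the pointed metric space with underlying set $(\mathcal{M}\setminus\mathcal{N})\cup\{0\}$, base point $0$, and metric $\rho_{\mathcal{M}/\mathcal{N}}(x,y)=\min\{\rho(x,y),\rho(x,\mathcal{N})+\rho(y,\mathcal{N})\}$. Here $\mathbb{R}^d$ has the Euclidean metric, and its base point is chosen in $U^c$. $\mathrm{Lip}_{U^c}(\mathbb{R}^d)$ is the Banach space of Lipschitz functions $f\colon\mathbb{R}^d\to\mathbb{R}$ with $f|_{U^c}=0$, normed by the Lipschitz constant.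 $\mathcal{C}_0(U)^*$ is the space of finite signed Radon measures on $U$, regarded as functionals on $\mathrm{Lip}_{U^c}(\mathbb{R}^d)$ by integration. $W^{-1,1}(U)$ is defined as the closure of $\mathcal{C}_0(U)^*$ in $\mathrm{Lip}_{U^c}(\mathbb{R}^d)^*$ with respect to the dual norm. *)

(* Defs.v *)
From HB Require Import structures.
From mathcomp Require Import all_boot all_order all_algebra.
From mathcomp Require Import all_classical all_reals all_analysis.
From mathcomp Require Import ring lra.

Set Implicit Arguments.
Unset Strict Implicit.
Unset Printing Implicit Defensive.

Import Order.TTheory GRing.Theory Num.Theory.
Import numFieldNormedType.Exports.

Local Open Scope classical_set_scope.
Local Open Scope ring_scope.

(* The library normalises ['rV[R]_d] by the maximum norm. [euclid R d] is an
   alias that only inherits the vector space structure and is given the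
   Euclidean norm, metric and topology instead. *)
Definition euclid (R : realType) (d : nat) : Type := 'rV[R]_d.

HB.instance Definition _ (R : realType) (d : nat) :=
  GRing.Lmodule.copy (euclid R d) 'rV[R]_d.

Section Euclid.
Context (R : realType) (d : nat).
Implicit Types x y : euclid R d.

Definition euclid_norm x : R :=
  Num.sqrt (\sum_(i < d) (x : 'rV[R]_d) ord0 i ^+ 2).

Let cauchy_schwarz (a b : 'I_d -> R) :
  (\sum_i a i * b i) ^+ 2 <= (\sum_i a i ^+ 2) * (\sum_i b i ^+ 2).
Proof.
set P := \sum_i a i * b i; set X := \sum_i a i ^+ 2; set Y := \sum_i b i ^+ 2.
have Y0 : 0 <= Y by apply: sumr_ge0 => i _; exact: sqr_ge0.
have key : \sum_i (Y * a i - P * b i) ^+ 2 = Y * (X * Y - P ^+ 2).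
  transitivity (Y ^+ 2 * X - (Y * P) *+ 2 * P + P ^+ 2 * Y).
    rewrite (mulr_sumr _ _ _ (Y ^+ 2)) {2}/P (mulr_sumr _ _ _ ((Y * P) *+ 2)).
    rewrite [in RHS]/Y (mulr_sumr _ _ _ (P ^+ 2)) -/Y -sumrB -big_split/=.
    by apply: eq_bigr => i _; rewrite mulr2n; ring.
  by rewrite mulr2n; ring.
have [Yp|] := ltP 0 Y.
  rewrite -subr_ge0 -(pmulr_rge0 _ Yp) -key.
  by apply: sumr_ge0 => i _; exact: sqr_ge0.
move=> Yn; have /eqP Y00 : Y == 0 by rewrite eq_le Yn Y0.
have b0 i : b i = 0.
  apply/eqP; rewrite -sqrf_eq0 eq_le sqr_ge0 andbT -Y00.
  by rewrite /Y (bigD1 i)//= lerDl; apply: sumr_ge0 => j _; exact: sqr_ge0.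
by rewrite Y00 mulr0 /P big1 ?expr0n// => i _; rewrite b0 mulr0.
Qed.

Lemma euclid_normD x y : euclid_norm (x + y) <= euclid_norm x + euclid_norm y.
Proof.
rewrite /euclid_norm.
set a := fun i : 'I_d => (x : 'rV[R]_d) ord0 i.
set b := fun i : 'I_d => (y : 'rV[R]_d) ord0 i.
have X0 : 0 <= \sum_i a i ^+ 2 by apply: sumr_ge0 => i _; exact: sqr_ge0.
have Y0 : 0 <= \sum_i b i ^+ 2 by apply: sumr_ge0 => i _; exact: sqr_ge0.
have -> : \sum_(i < d) ((x + y : euclid R d) : 'rV[R]_d) ord0 i ^+ 2 =
    \sum_i a i ^+ 2 + (\sum_i a i * b i) *+ 2 + \sum_i b i ^+ 2.
  rewrite -sumrMnl -!big_split/=; apply: eq_bigr => i _.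
  by rewrite -sqrrD mxE.
rewrite -[leRHS]ger0_norm ?addr_ge0 ?sqrtr_ge0// -sqrtr_sqr.
rewrite ler_wsqrtr// sqrrD !sqr_sqrtr// lerD2r lerD2l lerMn2r/=.
by rewrite -sqrtrM// (le_trans (ler_norm _))// -sqrtr_sqr ler_wsqrtr.
Qed.

Lemma euclid_normZ (l : R) x : euclid_norm (l *: x) = `|l| * euclid_norm x.
Proof.
rewrite /euclid_norm -sqrtr_sqr -sqrtrM ?sqr_ge0// mulr_sumr.
by congr Num.sqrt; apply: eq_bigr => i _; rewrite mxE exprMn.
Qed.

Lemma euclid_norm0_eq0 x : euclid_norm x = 0 -> x = 0.
Proof.
move=> /eqP; rewrite sqrtr_eq0 => x0; apply/rowP => i; rewrite mxE.
apply/eqP; rewrite -sqrf_eq0 eq_le sqr_ge0 andbT (le_trans _ x0)//.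
by rewrite (bigD1 i)//= lerDl; apply: sumr_ge0 => j _; exact: sqr_ge0.
Qed.

HB.instance Definition _ := Lmodule_isNormed.Build R (euclid R d)
  euclid_normD euclid_normZ euclid_norm0_eq0.

Let euclid_dist_ge0 x y : 0 <= `|x - y|. Proof. exact: normr_ge0. Qed.

Let euclid_dist_eq0 x y : `|x - y| = 0 -> x = y.
Proof. by move/normr0_eq0/eqP; rewrite subr_eq0 => /eqP. Qed.

Let euclid_ballE x (e : R) : ball x e = [set y | `|x - y| < e].
Proof. by rewrite -ball_normE. Qed.

HB.instance Definition _ := PseudoMetric_isMetric.Build R (euclid R d)
  euclid_dist_ge0 euclid_dist_eq0 euclid_ballE.

End Euclid.

Section LipschitzMaps.
Context (R : realType) (M : metricType R) (X : normedModType R).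
Implicit Type f : M -> X.

Definition lipschitz_map f :=
  exists k : R, forall x y, `|f x - f y| <= k * mdist x y.

(* Meaningful when [lipschitz_map f]; it is 0 when [M] has only one point. *)
Definition lip_const f : R :=
  sup [set `|f p.1 - f p.2| / mdist p.1 p.2 | p in [set p : M * M | p.1 != p.2]].

Lemma lip_const_le f k : 0 <= k ->
  (forall x y, `|f x - f y| <= k * mdist x y) -> lip_const f <= k.
Proof.
move=> k0 fk; rewrite /lip_const; set A := [set _ | _ in _].
have [->|A0] := eqVneq A set0; first by rewrite sup0.
apply: ge_sup; first exact/set0P.
by move=> _ [[x y] /= xy <-]; rewrite ler_pdivrMr ?mdist_gt0.
Qed.

Lemma lip_constP f x y : lipschitz_map f ->
  `|f x - f y| <= lip_const f * mdist x y.
Proof.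
move=> [k fk]; have [->|xy] := eqVneq x y.
  by rewrite subrr normr0 mdistxx mulr0.
rewrite -ler_pdivrMr ?mdist_gt0//; apply: ub_le_sup; last by exists (x, y).
by exists k => _ [[u v] /= uv <-]; rewrite ler_pdivrMr ?mdist_gt0.
Qed.

Lemma lip_const_ge0 f : lipschitz_map f -> 0 <= lip_const f.
Proof.
move=> fL; rewrite /lip_const; set A := [set _ | _ in _].
have [->|/set0P[_ [[x y] /= xy _]]] := eqVneq A set0; first by rewrite sup0.
rewrite -(@pmulr_lge0 _ (mdist x y)) ?mdist_gt0//.
exact: le_trans (normr_ge0 _) (lip_constP x y fL).
Qed.

End LipschitzMaps.

Definition op_norm (R : realType) (V W : normedModType R) (T : V -> W) : R :=
  sup [set `|T v| | v in [set v : V | `|v| <= 1]].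

(* The universal property that determines the free space of the metric space
   [M] with base point [x0] up to linear isometry. *)
Record is_lipschitz_free (R : realType) (M : metricType R) (x0 : M)
    (F : completeNormedModType R) (delta : M -> F) : Prop := {
  free_isometry : forall x y, `|delta x - delta y| = mdist x y ;
  free_base : delta x0 = 0 ;
  free_universal : forall (X : completeNormedModType R) (f : M -> X),
    lipschitz_map f -> f x0 = 0 ->
    exists T : {linear F -> X},
      [/\ continuous T, (forall x, T (delta x) = f x),
          op_norm T = lip_const f &
          forall T' : {linear F -> X}, continuous T' ->
            (forall x, T' (delta x) = f x) -> T' =1 T]
}.

Definition dist_to_set (R : realType) (M : metricType R) (N : set M) (x : M) : R :=
  inf [set mdist x y | y in N].

(* The proofs [cN] and [Nx0] are parameters of the type because the quotient
   distance separates points only when [N] is closed and nonempty. *)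
Record quotient_space (R : realType) (M : metricType R) (N : set M) (x0 : M)
    (cN : closed N) (Nx0 : N x0) := QuotientPoint {
  quotient_val : M ;
  _ : quotient_val \in ~` N `|` [set x0] }.

Section QuotientSpace.
Context (R : realType) (M : metricType R) (N : set M) (x0 : M).
Context (cN : closed N) (Nx0 : N x0).
Local Notation Q := (quotient_space cN Nx0).

HB.instance Definition _ := [isSub of Q for @quotient_val R M N x0 cN Nx0].
HB.instance Definition _ := [Choice of Q by <:].

Lemma quotient_base_subproof : x0 \in ~` N `|` [set x0].
Proof. by rewrite inE; right. Qed.

Definition quotient_base : Q := QuotientPoint cN Nx0 quotient_base_subproof.

Definition quotient_dist (p q : Q) : R :=
  Num.min (mdist (val p) (val q))
    (dist_to_set N (val p) + dist_to_set N (val q)).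

Let has_lbound_dist x : has_lbound [set mdist x y | y in N].
Proof. by exists 0 => _ [y _ <-]; exact: mdist_ge0. Qed.

Let dist_to_set_ge0 x : 0 <= dist_to_set N x.
Proof.
apply: lb_le_inf; first by exists (mdist x x0), x0.
by move=> _ [y _ <-]; exact: mdist_ge0.
Qed.

Let dist_to_set_le x y : dist_to_set N x <= mdist x y + dist_to_set N y.
Proof.
rewrite -lerBlDl; apply: lb_le_inf; first by exists (mdist y x0), x0.
move=> _ [z Nz <-]; rewrite lerBlDl (le_trans _ (metric_triangle x y z))//.
by apply: ge_inf => //; exists z.
Qed.

Let dist_to_set_eq0 x : dist_to_set N x = 0 -> N x.
Proof.
move=> x0N; apply: cN => B; rewrite -nbhs_ballE => -[e /= e0 xeB].
have [|_ [y Ny <-] xye] := @inf_adherent _ [set mdist x y | y in N] e e0.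
  by split=> //; exists (mdist x x0), x0.
exists y; split => //; apply: xeB; rewrite ballEmdist/=.
by move: xye; rewrite -/(dist_to_set N x) x0N add0r.
Qed.

Let quotient_distxx p : quotient_dist p p = 0.
Proof. by rewrite /quotient_dist mdistxx min_l// addr_ge0. Qed.

Let quotient_dist_sym p q : quotient_dist p q = quotient_dist q p.
Proof. by rewrite /quotient_dist metric_sym addrC. Qed.

Let quotient_dist_positivity p q : quotient_dist p q = 0 -> p = q.
Proof.
have base (r : Q) : N (val r) -> val r = x0.
  have : val r \in ~` N `|` [set x0] := valP r.
  by rewrite inE => -[].
rewrite /quotient_dist; case: leP => _ pq0; apply: val_inj.
  exact: mdist_positivity.
move/eqP: pq0; rewrite paddr_eq0// => /andP[/eqP p0 /eqP q0].
exact: etrans (base p (dist_to_set_eq0 p0)) (esym (base q (dist_to_set_eq0 q0))).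
Qed.

Let quotient_dist_triangle q p r :
  quotient_dist p r <= quotient_dist p q + quotient_dist q r.
Proof.
rewrite /quotient_dist ge_min.
have pq := dist_to_set_le (val p) (val q).
have rq := dist_to_set_le (val r) (val q).
have q0 := dist_to_set_ge0 (val q).
have rq' := metric_sym (val r) (val q).
have tri := metric_triangle (val p) (val q) (val r).
case: (leP (mdist (val p) (val q))) => _;
  case: (leP (mdist (val q) (val r))) => _; apply/orP;
  by [left; lra|right; lra].
Qed.

HB.instance Definition _ := isMetric.Build R Q
  quotient_distxx quotient_dist_positivity quotient_dist_sym
  quotient_dist_triangle.

End QuotientSpace.

Definition lip_pred (R : realType) (M : metricType R) (N : set M) :
    {pred M -> R^o} :=
  fun f => `[< lipschitz_map f /\ forall x, N x -> f x = 0 >].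

(* [N0] makes the Lipschitz constant a norm: it excludes nonzero constants. *)
Record lip_space (R : realType) (M : metricType R) (N : set M)
    (N0 : N !=set0) := LipFun {
  lip_fun :> M -> R^o ;
  _ : lip_fun \in lip_pred N }.

Section LipSpace.
Context (R : realType) (M : metricType R) (N : set M) (N0 : N !=set0).
Local Notation L := (lip_space N0).

HB.instance Definition _ := [isSub of L for @lip_fun R M N N0].
HB.instance Definition _ := [Choice of L by <:].

Let lip_submod_closed : submod_closed (lip_pred N).
Proof.
split; first by apply/asboolP; split=> //; exists 0 => x y; rewrite subrr normr0 mul0r.
move=> a f g /asboolP[[k fk] f0] /asboolP[[l gl] g0]; apply/asboolP; split.
  exists (`|a| * k + l) => x y.
  rewrite !fctE/= opprD addrACA -scalerBr (le_trans (ler_normD _ _))//.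
  by rewrite mulrDl lerD// normrZ -mulrA ler_wpM2l.
by move=> x Nx; rewrite !fctE/= f0// g0// scaler0 addr0.
Qed.

HB.instance Definition _ :=
  GRing.isSubmodClosed.Build R (M -> R^o) (lip_pred N) lip_submod_closed.
HB.instance Definition _ := [SubChoice_isSubLmodule of L by <:].

Lemma lip_space_lipschitz (f : L) : lipschitz_map f.
Proof. by case: f => f /= /asboolP[]. Qed.

Lemma lip_space_eq0 (f : L) x : N x -> f x = 0.
Proof. by case: f => f /= /asboolP[_]; exact. Qed.

Let lip_normD (f g : L) :
  lip_const (f + g : L) <= lip_const f + lip_const g.
Proof.
apply: lip_const_le; first by rewrite addr_ge0// lip_const_ge0//; exact: lip_space_lipschitz.
move=> x y; rewrite /= !fctE opprD addrACA (le_trans (ler_normD _ _))// mulrDl.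
by rewrite lerD//; apply: lip_constP; exact: lip_space_lipschitz.
Qed.

Let lip_normZ_le (a : R) (f : L) : lip_const (a *: f : L) <= `|a| * lip_const f.
Proof.
apply: lip_const_le.
  by rewrite mulr_ge0// lip_const_ge0//; exact: lip_space_lipschitz.
move=> x y; rewrite /= !fctE -scalerBr normrZ -mulrA ler_wpM2l//.
by apply: lip_constP; exact: lip_space_lipschitz.
Qed.

Let lip_normZ (a : R) (f : L) : lip_const (a *: f : L) = `|a| * lip_const f.
Proof.
apply/eqP; rewrite eq_le lip_normZ_le andTb.
have [->|a0] := eqVneq a 0.
  by rewrite normr0 mul0r lip_const_ge0//; exact: lip_space_lipschitz.
have := lip_normZ_le a^-1 (a *: f).
by rewrite scalerA mulVf// scale1r normfV ler_pdivlMl ?normr_gt0.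
Qed.

Let lip_norm0_eq0 (f : L) : lip_const f = 0 -> f = 0.
Proof.
move=> f0; apply/val_inj/funext => x /=; have [z Nz] := N0.
have := lip_constP x z (lip_space_lipschitz f).
by rewrite f0 mul0r (lip_space_eq0 f Nz) subr0 normr_le0 => /eqP.
Qed.

HB.instance Definition _ :=
  Lmodule_isNormed.Build R L lip_normD lip_normZ lip_norm0_eq0.

End LipSpace.

Definition dual_pred (R : realType) (V : normedModType R) : {pred V -> R^o} :=
  fun f => `[< linear f /\ continuous f >].

Record dual (R : realType) (V : normedModType R) := DualFun {
  dual_fun :> V -> R^o ;
  _ : dual_fun \in @dual_pred R V }.

Section Dual.
Context (R : realType) (V : normedModType R).
Local Notation D := (dual V).

HB.instance Definition _ := [isSub of D for @dual_fun R V].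
HB.instance Definition _ := [Choice of D by <:].

Let dual_submod_closed : submod_closed (@dual_pred R V).
Proof.
split.
  apply/asboolP; split; last exact: cst_continuous.
  by move=> a u v; rewrite scaler0 addr0.
move=> a f g /asboolP[lf cf] /asboolP[lg cg]; apply/asboolP; split.
  move=> b u v; rewrite !fctE/= lf lg !scalerDr !scalerA (mulrC a b).
  by rewrite addrACA.
move=> x; apply: (@cvgD _ _ _ _ _ (fun x => a *: f x) g); last exact: cg.
by apply: cvgZ; [exact: cvg_cst|exact: cf].
Qed.

HB.instance Definition _ :=
  GRing.isSubmodClosed.Build R (V -> R^o) (@dual_pred R V) dual_submod_closed.
HB.instance Definition _ := [SubChoice_isSubLmodule of D by <:].

Lemma dual_linear (f : D) : linear f.
Proof. by case: f => f /= /asboolP[]. Qed.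

Lemma dual_continuous (f : D) : continuous f.
Proof. by case: f => f /= /asboolP[]. Qed.

HB.instance Definition _ (f : D) :=
  GRing.isLinear.Build R V R^o *:%R f (dual_linear f).

Let dual_bounded (f : D) : has_ubound [set `|f v| | v in [set v : V | `|v| <= 1]].
Proof.
have /linear_boundedP/pinfty_ex_gt0[k k0 fk] : bounded_near f (nbhs (0 : V)).
  by apply/linear_bounded_continuous; exact: dual_continuous.
by exists k => _ [v /= v1 <-]; rewrite (le_trans (fk v))// ler_piMr// ltW.
Qed.

Let dual_ubP (f : D) v : `|v| <= 1 -> `|f v| <= op_norm f.
Proof. by move=> v1; apply: ub_le_sup => //; exists v. Qed.

Let dual_norm_le (f : D) (k : R) :
  (forall v, `|v| <= 1 -> `|f v| <= k) -> op_norm f <= k.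
Proof.
move=> fk; apply: ge_sup; last by move=> _ [v v1 <-]; exact: fk.
by exists `|f 0|, 0 => //=; rewrite normr0.
Qed.

Let dual_normD (f g : D) : op_norm (f + g : D) <= op_norm f + op_norm g.
Proof.
apply: dual_norm_le => v v1; rewrite /= fctE (le_trans (ler_normD _ _))//.
by rewrite lerD// dual_ubP.
Qed.

Let dual_normZ_le (a : R) (f : D) : op_norm (a *: f : D) <= `|a| * op_norm f.
Proof.
by apply: dual_norm_le => v v1; rewrite /= fctE normrZ ler_wpM2l// dual_ubP.
Qed.

Let dual_norm_ge0 (f : D) : 0 <= op_norm f.
Proof. by rewrite (le_trans _ (@dual_ubP f 0 _)) ?normr0. Qed.

Let dual_normZ (a : R) (f : D) : op_norm (a *: f : D) = `|a| * op_norm f.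
Proof.
apply/eqP; rewrite eq_le dual_normZ_le andTb.
have [->|a0] := eqVneq a 0; first by rewrite normr0 mul0r.
have := dual_normZ_le a^-1 (a *: f).
by rewrite scalerA mulVf// scale1r normfV ler_pdivlMl ?normr_gt0.
Qed.

Let dual_norm0_eq0 (f : D) : op_norm f = 0 -> f = 0.
Proof.
move=> f0; apply/val_inj/funext => v /=.
have [->|v0] := eqVneq v 0; first exact: linear0.
have := @dual_ubP f (`|v|^-1 *: v); rewrite f0.
rewrite normrZ normfV normr_id mulVf ?normr_eq0// lexx => /(_ isT).
rewrite linearZ/= normr_le0 scaler_eq0 invr_eq0 normr_eq0 (negbTE v0)/=.
by move/eqP.
Qed.

HB.instance Definition _ :=
  Lmodule_isNormed.Build R D dual_normD dual_normZ dual_norm0_eq0.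

End Dual.

Definition borel (R : realType) (d : nat) :=
  g_sigma_algebraType (@open (euclid R d)).

Section SignedMeasures.
Context (R : realType) (d : nat).
Implicit Type nu : {charge set (borel R d) -> \bar R}.

Lemma hahn_pair nu : {PN : set (borel R d) * set (borel R d) |
  hahn_decomposition nu PN.1 PN.2}.
Proof.
by apply: cid; have [P [N PN]] := Hahn_decomposition nu; exists (P, N).
Qed.

Definition positive_part nu := jordan_pos (svalP (hahn_pair nu)).
Definition negative_part nu := jordan_neg (svalP (hahn_pair nu)).
Definition total_variation nu := charge_variation (svalP (hahn_pair nu)).

Definition charge_integral nu (U : set (borel R d)) (f : borel R d -> R) : R :=
  \int[positive_part nu]_(x in U) f x - \int[negative_part nu]_(x in U) f x.

(* A finite signed Borel measure on [U] is identified with its extension by 0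
   to a charge on the Borel sets of R^d. Charges being finite, the Radon
   property amounts to inner regularity of the total variation. *)
Definition radon_on (U : set (euclid R d)) nu :=
  (forall A : set (borel R d), measurable A -> A `<=` ~` U -> nu A = 0%E) /\
  (forall A : set (borel R d), measurable A -> A `<=` U ->
    total_variation nu A =
    ereal_sup [set total_variation nu K | K in
      [set K : set (euclid R d) | compact K /\ K `<=` A]]).

End SignedMeasures.

Section SobolevSpace.
Context (R : realType) (d : nat) (U : set (euclid R d)) (UC0 : ~` U !=set0).

Definition measure_functionals : set (dual (lip_space UC0)) :=
  [set phi | exists nu : {charge set (borel R d) -> \bar R},
     radon_on U nu /\
     forall f : lip_space UC0, phi f = charge_integral nu U f].

Definition sobolev_neg1_1 : set (dual (lip_space UC0)) :=
  closure measure_functionals.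

End SobolevSpace.
Arguments measure_functionals {R d U} UC0.
Arguments sobolev_neg1_1 {R d U} UC0.

Definition linearly_isometric (R : realType) (F E : normedModType R)
    (W : set E) :=
  exists T : {linear F -> E}, (forall v, `|T v| = `|v|) /\ range T = W.

(* Main.v *)
Require Import Defs.
From HB Require Import structures.
From mathcomp Require Import all_boot all_order all_algebra.
From mathcomp Require Import all_classical all_reals all_analysis.
From mathcomp Require Import measurable_realfun ring lra.

Import Order.TTheory GRing.Theory Num.Theory.
Import numFieldNormedType.Exports.

Local Open Scope classical_set_scope.
Local Open Scope ring_scope.

(** Write [N] for the complement of [U], [Q] for the quotient of the Euclidean
    space by [N], [L] for the Lipschitz functions vanishing on [N].

    A function of [L] restricts to [Q], a Lipschitz function on [Q] vanishing
    at the base point extends by zero, and neither operation increases the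
    Lipschitz constant ([lip_space_on_quotient], [lip_space_of_quotient]).  So
    each [f] in [L] is the restriction to [Q] of a unique bounded linear form
    [extend f] on the free space [F], and the candidate isometry sends [v] to
    [functional v], the evaluation [f |-> extend f v].

    It is norm-decreasing because [extend f] is bounded by the Lipschitz
    constant of [f].  It is norm-preserving by Hahn-Banach: a linear form of
    norm at most one attaining the norm of [v] is [extend f] for a 1-Lipschitz
    [f] ([functional_isometry]).

    Its range lies in the closure of the measures: [functional] sends [delta x]
    to the Dirac mass at [x], combinations of Dirac masses are finitely
    supported (hence clearly Radon) measures, and the span of the [delta x] is
    dense in [F], again by Hahn-Banach ([free_span_dense],
    [functional_closure]).

    Conversely, [U] being bounded, it is cut into finitely many Borel pieces of
    small diameter.  Replacing a finite measure by the combination of Dirac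
    masses that puts the mass of each piece at one of its points changes its
    integral against [f] by little, uniformly for [f] in the unit ball of [L]
    ([measure_approximation]).  So every measure is a limit of elements of the
    range, and the range of an isometry defined on a complete space is closed
    ([closure_range_isometry], [closure_functional]). *)

(** * The Hahn-Banach theorem *)

Section HahnBanach.
Context {R : realType} {V : lmodType R}.
Implicit Types (p q : V -> R) (x y v : V).

Definition sublinear p :=
  (forall x y, p (x + y) <= p x + p y) /\
  (forall (c : R) x, 0 <= c -> p (c *: x) <= c * p x).

Lemma sublinear0 p : sublinear p -> p 0 = 0.
Proof.
move=> [pD pZ]; apply/eqP; rewrite eq_le.
have := pZ 0 0 (lexx _); rewrite scale0r mul0r => ->/=.
by have := pD 0 0; rewrite addr0; lra.
Qed.

Lemma sublinear_ge p x : sublinear p -> - p (- x) <= p x.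
Proof.
by move=> sp; have := sp.1 x (- x); rewrite subrr sublinear0//; lra.
Qed.

Let tilt_set p v x :=
  [set p (x + t *: v) - t * p v | t in [set t : R | 0 <= t]].

(** The largest sublinear function below [p] that is additive in the direction
    [v], in the sense that adding [v] to the argument adds [p v] to the value.
    A sublinear function equal to all its tilts is therefore linear. *)
Definition tilt p v x : R := inf (tilt_set p v x).

Let tilt_set_has_lbound p v x : sublinear p ->
  lbound (tilt_set p v x) (- p (- x)).
Proof.
move=> [pD pZ] _ [t /= t0 <-].
have := pD (x + t *: v) (- x); rewrite addrAC subrr add0r => h.
have := pZ t^-1 (t *: v); rewrite invr_ge0 t0 => /(_ isT).
have [->|tn0] := eqVneq t 0.
  by have := sublinear_ge p x (conj pD pZ); rewrite scale0r addr0 mul0r; lra.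
rewrite scalerA mulVf// scale1r => h2.
have : t * p v <= p (t *: v) by rewrite -ler_pdivlMl// lt_neqAle eq_sym tn0.
lra.
Qed.

Lemma tilt_le p v x (t : R) : sublinear p -> 0 <= t ->
  tilt p v x <= p (x + t *: v) - t * p v.
Proof.
move=> sp t0; apply: ge_inf; last by exists t.
by exists (- p (- x)); exact: tilt_set_has_lbound.
Qed.

Lemma le_tilt p v x (a : R) :
  (forall t : R, 0 <= t -> a <= p (x + t *: v) - t * p v) -> a <= tilt p v x.
Proof.
move=> h; apply: lb_le_inf; last by move=> _ [t /= t0 <-]; exact: h.
by exists (p (x + 0 *: v) - 0 * p v), 0 => /=.
Qed.

Lemma tilt_le_id p v x : sublinear p -> tilt p v x <= p x.
Proof.
move=> sp; have := @tilt_le p v x 0 sp (lexx _).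
by rewrite scale0r addr0 mul0r subr0.
Qed.

Lemma tilt_opp_le p v : sublinear p -> tilt p v (- v) <= - p v.
Proof.
move=> sp; have := @tilt_le p v (- v) 1 sp ler01.
by rewrite scale1r addNr sublinear0// sub0r mul1r.
Qed.

Lemma tilt_sublinear p v : sublinear p -> sublinear (tilt p v).
Proof.
move=> sp; have [pD pZ] := sp; split=> [x y|c x c0].
  rewrite -lerBlDr; apply: le_tilt => t t0.
  rewrite lerBlDr -lerBlDl; apply: le_tilt => s s0.
  rewrite lerBlDl (le_trans (tilt_le p v (x + y) _ sp (addr_ge0 t0 s0)))//.
  have := pD (x + t *: v) (y + s *: v).
  by rewrite addrACA -scalerDl; lra.
have [->|cn0] := eqVneq c 0.
  by rewrite scale0r mul0r (le_trans (tilt_le_id _ _ _ sp))// sublinear0.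
have {}c0 : 0 < c by rewrite lt_neqAle eq_sym cn0.
rewrite -ler_pdivrMl//; apply: le_tilt => t t0.
rewrite ler_pdivrMl//.
have ct0 : 0 <= c * t by rewrite mulr_ge0// ltW.
rewrite (le_trans (tilt_le p v (c *: x) _ sp ct0))//.
have := pZ c (x + t *: v) (ltW c0).
by rewrite scalerDr scalerA mulrBr mulrA; lra.
Qed.

Definition below p := {q | sublinear q /\ forall x, q x <= p x}.

Definition mk_below p q (sq : sublinear q) (qp : forall x, q x <= p x) : below p :=
  exist _ q (conj sq qp).

(** Zorn's lemma applies because the pointwise infimum of a chain of sublinear
    functions below [p] is finite, being at least [x |-> - p (- x)], and
    subadditive, two members of the chain being comparable. *)
Lemma minimal_sublinear p : sublinear p ->
  exists q, [/\ sublinear q, forall x, q x <= p x &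
    forall r, sublinear r -> (forall x, r x <= q x) -> r = q].
Proof.
move=> sp.
pose ge (a b : below p) := `[< forall x, sval b x <= sval a x >].
have [||||[q [sq qp]] qmin] := @Zorn (below p) ge.
- by move=> a; apply/asboolP.
- move=> b a c /asboolP ab /asboolP bc; apply/asboolP => x.
  exact: le_trans (bc x) (ab x).
- move=> [a Pa] [b Pb] /asboolP ab /asboolP ba; apply/eq_exist/funext => x.
  by apply/eqP; rewrite eq_le ab ba.
- move=> A totA.
  have [A0|/set0P[a0 Aa0]] := eqVneq A set0.
    by exists (mk_below p p sp (fun x => lexx _)) => s; rewrite A0.
  pose S x := [set sval a x | a in A].
  have lbS x : lbound (S x) (- p (- x)).
    move=> _ [[a [sa ap]] _ <-] /=.
    by rewrite (le_trans _ (sublinear_ge a x sa))// lerN2.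
  have qle a x : A a -> inf (S x) <= sval a x.
    by move=> Aa; apply: ge_inf; [exists (- p (- x))|exists a].
  have qge c x : (forall a, A a -> c <= sval a x) -> c <= inf (S x).
    move=> h; apply: lb_le_inf; first by exists (sval a0 x), a0.
    by move=> _ [a Aa <-]; exact: h.
  have sq : sublinear (fun x => inf (S x)).
    split=> [x y|c x c0] /=.
      rewrite -lerBlDr; apply: (qge) => a Aa.
      rewrite lerBlDr -lerBlDl; apply: (qge) => b Ab.
      rewrite lerBlDl.
      have [/asboolP ab|/asboolP ba] := totA _ _ Aa Ab.
        rewrite (le_trans (qle _ _ Ab))// (le_trans ((svalP b).1.1 _ _))//.
        by rewrite lerD2r; exact: ab.
      rewrite (le_trans (qle _ _ Aa))// (le_trans ((svalP a).1.1 _ _))//.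
      by rewrite lerD2l; exact: ba.
    have [->|cn0] := eqVneq c 0.
      rewrite scale0r mul0r (le_trans (qle _ _ Aa0))// sublinear0//.
      exact: (svalP a0).1.
    have {}c0 : 0 < c by rewrite lt_neqAle eq_sym cn0.
    rewrite -ler_pdivrMl//; apply: (qge) => a Aa.
    rewrite ler_pdivrMl// (le_trans (qle _ _ Aa))//.
    exact: (svalP a).1.2 _ _ (ltW c0).
  have qp x : inf (S x) <= p x.
    by rewrite (le_trans (qle _ _ Aa0))//; exact: (svalP a0).2.
  by exists (mk_below p _ sq qp) => a Aa; apply/asboolP => x; exact: qle.
exists q; split=> // r sr rq.
have rp x : r x <= p x by exact: le_trans (rq x) (qp x).
have /= := qmin (mk_below p r sr rp).
by move=> /(_ _)/(congr1 sval)/=; apply; apply/asboolP.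
Qed.

(** A minimal sublinear function [q] below [tilt p v] equals all its own tilts,
    so it is linear; and [q (- v) <= tilt p v (- v) <= - p v] forces
    [q v = p v].  Working with minimal sublinear functions avoids extending
    forms from subspaces one dimension at a time. *)
Lemma hahn_banach p v : sublinear p ->
  exists phi : {linear V -> R^o}, (forall x, phi x <= p x) /\ phi v = p v.
Proof.
move=> sp; have [q [sq qt qmin]] := minimal_sublinear _ (tilt_sublinear p v sp).
have qle x y : q x + q y <= q (x + y).
  rewrite -(qmin _ (tilt_sublinear q y sq)) => [|z]; last exact: tilt_le_id.
  have := @tilt_le q y x 1 sq ler01; rewrite scale1r mul1r.
  rewrite (qmin _ (tilt_sublinear q y sq)) => [|z]; first lra.
  exact: tilt_le_id.
have qD x y : q (x + y) = q x + q y.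
  by apply/eqP; rewrite eq_le qle sq.1.
have qN x : q (- x) = - q x.
  by have := qD x (- x); rewrite subrr sublinear0//; lra.
have qZ0 (c : R) x : 0 <= c -> q (c *: x) = c * q x.
  move=> c0; apply/eqP; rewrite eq_le sq.2//=.
  by have := sq.2 c (- x) c0; rewrite scalerN !qN; lra.
have qlin : linear (q : V -> R^o).
  move=> a x y; rewrite qD; congr (_ + _).
  have [a0|a0] := leP 0 a; first exact: qZ0.
  have := qZ0 (- a) x; rewrite scaleNr qN oppr_ge0 => /(_ (ltW a0)).
  by rewrite mulNr => /oppr_inj.
pose Q := GRing.isLinear.Build R V R^o *:%R q qlin.
pose phi : {linear V -> R^o} := HB.pack (q : V -> R^o) Q.
exists phi; split=> [x|]; first exact: le_trans (qt x) (tilt_le_id _ _ _ sp).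
apply/eqP; rewrite eq_le (le_trans (qt v) (tilt_le_id _ _ _ sp))/=.
by have := le_trans (qt (- v)) (tilt_opp_le p v sp); rewrite qN lerN2.
Qed.

End HahnBanach.

(** * Bounded linear maps and functionals *)

Section BoundedLinear.
Context {R : realType} {V W : normedModType R}.
Implicit Types (T : {linear V -> W}).

Lemma linear_continuous_of_bound T (k : R) :
  (forall v, `|T v| <= k * `|v|) -> continuous T.
Proof.
move=> Tk; apply: bounded_linear_continuous; apply/linear_boundedP.
exists k; split; first exact: num_real.
by move=> r kr v; rewrite (le_trans (Tk v))// ler_wpM2r// ltW.
Qed.

Lemma op_norm_ge T v : continuous T -> `|T v| <= op_norm T * `|v|.
Proof.
move=> cT.
have /linear_boundedP/pinfty_ex_gt0[k k0 Tk] : bounded_near T (nbhs (0 : V)).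
  exact/linear_bounded_continuous.
have [->|v0] := eqVneq v 0; first by rewrite linear0 !normr0 mulr0.
rewrite -ler_pdivrMr ?normr_gt0// mulrC.
have -> : `|v|^-1 * `|T v| = `|T (`|v|^-1 *: v)|.
  by rewrite linearZ normrZ normfV normr_id.
apply: ub_le_sup; last first.
  by exists (`|v|^-1 *: v) => //=; rewrite normrZ normfV normr_id mulVf ?normr_eq0.
exists k => _ [u /= u1 <-].
by rewrite (le_trans (Tk u))// ler_piMr// ltW.
Qed.

Lemma op_norm_le T (k : R) : 0 <= k -> (forall v, `|T v| <= k * `|v|) ->
  op_norm T <= k.
Proof.
move=> k0 Tk; apply: ge_sup; first by exists `|T 0|, 0 => //=; rewrite normr0.
by move=> _ [v /= v1 <-]; rewrite (le_trans (Tk v))// ler_piMr.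
Qed.

End BoundedLinear.

Section Functionals.
Context {R : realType} {V : normedModType R}.

Lemma norm_bound_of_le (phi : {linear V -> R^o}) :
  (forall x, phi x <= `|x|) -> forall x, `|phi x| <= `|x|.
Proof.
move=> h x; rewrite ler_norml h andbT lerNl.
by rewrite -linearN -(normrN x) h.
Qed.

Lemma norming_functional (v : V) :
  exists phi : {linear V -> R^o}, (forall x, `|phi x| <= `|x|) /\ phi v = `|v|.
Proof.
have [|phi [phi_le phiv]] := hahn_banach (fun x : V => `|x|) v.
  split=> [x y|c x c0]; first exact: ler_normD.
  by rewrite normrZ ger0_norm.
by exists phi; split=> //; exact: norm_bound_of_le.
Qed.

(** Hahn-Banach applied to the distance to [S], a sublinear function that is
    zero on [S] and positive at [v]. *)
Lemma separating_functional (S : set V) (v : V) (e : R) :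
  S 0 -> (forall (a : R) u w, S u -> S w -> S (a *: u + w)) ->
  0 < e -> (forall s, S s -> e <= `|v - s|) ->
  exists phi : {linear V -> R^o},
    [/\ forall x, `|phi x| <= `|x|, forall s, S s -> phi s = 0 & phi v != 0].
Proof.
move=> S0 SZD e0 ve.
have SZ a u : S u -> S (a *: u) by move=> Su; rewrite -[_ *: _]addr0; exact: SZD.
have SD u w : S u -> S w -> S (u + w) by move=> Su; rewrite -[u]scale1r; exact: SZD.
pose p x : R := inf [set `|x - s| | s in S].
have ple x s : S s -> p x <= `|x - s|.
  by move=> Ss; apply: ge_inf; [exists 0 => _ [? _ <-] //|exists s].
have pge (a : R) x : (forall s, S s -> a <= `|x - s|) -> a <= p x.
  move=> h; apply: lb_le_inf; first by exists `|x - 0|, 0.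
  by move=> _ [s Ss <-]; exact: h.
have sp : sublinear p.
  split=> [x y|c x c0].
    rewrite -lerBlDr; apply: (pge) => s Ss.
    rewrite lerBlDr -lerBlDl; apply: (pge) => t St.
    rewrite lerBlDl (le_trans (ple _ _ (SD _ _ Ss St)))//.
    by rewrite opprD addrACA ler_normD.
  have [->|cn0] := eqVneq c 0.
    by rewrite scale0r mul0r (le_trans (ple _ _ S0))// subr0 normr0.
  have {}c0 : 0 < c by rewrite lt_neqAle eq_sym cn0.
  rewrite -ler_pdivrMl//; apply: (pge) => s Ss; rewrite ler_pdivrMl//.
  rewrite (le_trans (ple _ _ (SZ c _ Ss)))//.
  by rewrite -scalerBr normrZ gtr0_norm.
have [phi [phi_le phiv]] := hahn_banach p v sp.
exists phi; split.
- apply: norm_bound_of_le => x; rewrite (le_trans (phi_le x))//.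
  by rewrite (le_trans (ple _ _ S0))// subr0.
- move=> s Ss; apply/eqP; rewrite eq_le.
  have p0 t : S t -> phi t <= 0.
    move=> St; rewrite (le_trans (phi_le t))// (le_trans (ple _ _ St))//.
    by rewrite subrr normr0.
  rewrite p0//= -oppr_le0 -linearN p0// -scaleN1r; exact: SZ.
- by rewrite phiv gt_eqF// (lt_le_trans e0)// pge.
Qed.

End Functionals.

(** * Scalar functions on a Lipschitz free space *)

Section FreeSpace.
Context {R : realType} {M : metricType R} {x0 : M}.
Context {F : completeNormedModType R} {delta : M -> F}.
Context (free : is_lipschitz_free x0 delta).

Lemma free_scalar_extension (f : M -> R^o) : lipschitz_map f -> f x0 = 0 ->
  exists T : {linear F -> R^o}, (forall x, T (delta x) = f x) /\
    forall v, `|T v| <= lip_const f * `|v|.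
Proof.
move=> fL f0; have [T [cT Tf <- _]] := free_universal free fL f0.
by exists T; split=> // v; exact: op_norm_ge.
Qed.

Lemma delta_comp_lipschitz (T : {linear F -> R^o}) (k : R) :
  (forall v, `|T v| <= k * `|v|) ->
  forall x y, `|T (delta x) - T (delta y)| <= k * mdist x y.
Proof. by move=> Tk x y; rewrite -(free_isometry free) -linearB. Qed.

Lemma free_scalar_unique (T T' : {linear F -> R^o}) :
  continuous T -> continuous T' ->
  (forall x, T (delta x) = T' (delta x)) -> T =1 T'.
Proof.
move=> cT cT' TT'.
have fL : lipschitz_map (fun x => T (delta x) : R^o).
  exists (op_norm T); apply: delta_comp_lipschitz => v; exact: op_norm_ge.
have f0 : T (delta x0) = 0 by rewrite (free_base free) linear0.
have [S [_ _ _ SU]] := free_universal free fL f0.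
by move=> v; rewrite (SU T)// (SU T')// => x; rewrite TT'.
Qed.

(** A continuous form vanishing on the span of [delta] extends the zero
    function, so it is zero; hence no point can be separated from that span. *)
Lemma free_span_dense (S : set F) :
  S 0 -> (forall (a : R) u w, S u -> S w -> S (a *: u + w)) ->
  (forall x, S (delta x)) ->
  forall v (e : R), 0 < e -> exists2 s, S s & `|v - s| < e.
Proof.
move=> S0 SZD Sdelta v e e0; apply: contrapT => h.
have [|phi [phi_le phiS phiv]] := separating_functional S v e S0 SZD e0.
  by move=> s Ss; rewrite leNgt; apply/negP => vs; apply: h; exists s.
have phi0 : phi =1 (\0 : {linear F -> R^o}).
  apply: free_scalar_unique => [||x].
  - by apply: (linear_continuous_of_bound _ 1) => x; rewrite mul1r.
  - exact: cst_continuous.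
  - by rewrite phiS.
by move/eqP: phiv; apply; exact: phi0.
Qed.

End FreeSpace.

(** * Lipschitz functions on a quotient metric space *)

Section QuotientLip.
Context {R : realType} {M : metricType R} {N : set M} {x0 : M}.
Context (cN : closed N) (Nx0 : N x0).
Local Notation Q := (quotient_space cN Nx0).
Local Notation base := (quotient_base cN Nx0).
Local Notation L := (lip_space (ex_intro N x0 Nx0)).

Lemma dist_to_set_le (x y : M) : N y -> dist_to_set N x <= mdist x y.
Proof.
move=> Ny; apply: ge_inf; last by exists y.
by exists 0 => _ [z _ <-]; exact: mdist_ge0.
Qed.

Lemma lip_le_dist_to_set (f : M -> R^o) (k : R) x : 0 <= k ->
  (forall x y, `|f x - f y| <= k * mdist x y) -> (forall x, N x -> f x = 0) ->
  `|f x| <= k * dist_to_set N x.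
Proof.
move=> k0 fk fN.
have fy y : N y -> `|f x| <= k * mdist x y.
  by move=> Ny; rewrite -[f x]subr0 -(fN _ Ny).
(* The infimum can only be divided through by a positive [k]. *)
have [k00|kn0] := eqVneq k 0.
  by rewrite (le_trans (fy _ Nx0))// k00 !mul0r.
have {}k0 : 0 < k by rewrite lt_neqAle eq_sym kn0.
rewrite -ler_pdivrMl//; apply: lb_le_inf; first by exists (mdist x x0), x0.
by move=> _ [y Ny <-]; rewrite ler_pdivrMl// fy.
Qed.

(** Of the two terms whose minimum is the quotient distance, the second bounds
    the difference because each value is controlled by the distance to [N],
    where [f] vanishes. *)
Lemma lip_on_quotient (f : M -> R^o) (k : R) (p q : Q) : 0 <= k ->
  (forall x y, `|f x - f y| <= k * mdist x y) -> (forall x, N x -> f x = 0) ->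
  `|f (val p) - f (val q)| <= k * mdist p q.
Proof.
move=> k0 fk fN.
have -> : mdist p q = quotient_dist p q by [].
rewrite /quotient_dist minr_pMr// le_min fk/= mulrDr.
by rewrite (le_trans (ler_normB _ _))// lerD// lip_le_dist_to_set.
Qed.

(** The quotient map: as a subtype of [M] the quotient only provides the
    inclusion of its points, and [N] has to be sent to the base point. *)
Definition quotient_proj (x : M) : Q := insubd base x.

Lemma quotient_projK (p : Q) : quotient_proj (val p) = p.
Proof. exact: valKd. Qed.

Lemma val_quotient_proj x : ~ N x -> val (quotient_proj x) = x.
Proof. by move=> Nx; rewrite insubdK// inE; left. Qed.

Lemma quotient_proj_base x : N x -> quotient_proj x = base.
Proof.
move=> Nx; rewrite /quotient_proj /insubd; case: insubP => //= p + px.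
by rewrite inE => -[//|/= xx0]; apply: val_inj; exact: etrans px xx0.
Qed.

Lemma quotient_proj_contract x y :
  mdist (quotient_proj x) (quotient_proj y) <= mdist x y.
Proof.
have far u v : ~ N u -> N v -> mdist (quotient_proj u) (quotient_proj v) <= mdist u v.
  move=> Nu Nv; rewrite (quotient_proj_base _ Nv).
  have -> : mdist (quotient_proj u) base = quotient_dist (quotient_proj u) base by [].
  rewrite ge_min; apply/orP; right; rewrite val_quotient_proj//.
  have -> : val base = x0 by [].
  have := dist_to_set_le u v Nv; have := dist_to_set_le x0 x0 Nx0.
  by rewrite mdistxx; lra.
have [Nx|Nx] := pselect (N x); have [Ny|Ny] := pselect (N y).
- by rewrite !quotient_proj_base// mdistxx mdist_ge0.
- by rewrite metric_sym (metric_sym x); exact: far.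
- exact: far.
- have -> : mdist (quotient_proj x) (quotient_proj y) =
    quotient_dist (quotient_proj x) (quotient_proj y) by [].
  by rewrite /quotient_dist !val_quotient_proj// ge_min lexx.
Qed.

Lemma lip_norm_dist (f : L) x y : `|f x - f y| <= `|f| * mdist x y.
Proof. exact: lip_constP (lip_space_lipschitz f). Qed.

Lemma lip_space_on_quotient (f : L) :
  [/\ lipschitz_map (f \o val : Q -> R^o), (f \o val) base = 0
    & lip_const (f \o val : Q -> R^o) <= `|f|].
Proof.
have fQ (p q : Q) : `|f (val p) - f (val q)| <= `|f| * mdist p q.
  by apply: lip_on_quotient => // [x y|x]; [exact: lip_norm_dist|exact: lip_space_eq0].
split; first by exists `|f|.
- exact: lip_space_eq0.
- exact: lip_const_le.
Qed.

(** Composition with the quotient map is extension by zero, and the quotient map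
    is a contraction. *)
Lemma lip_space_of_quotient (g : Q -> R^o) (k : R) : 0 <= k ->
  (forall p q, `|g p - g q| <= k * mdist p q) -> g base = 0 ->
  exists f : L, (forall p, f (val p) = g p) /\ `|f| <= k.
Proof.
move=> k0 gk g0.
have fk x y : `|g (quotient_proj x) - g (quotient_proj y)| <= k * mdist x y.
  by rewrite (le_trans (gk _ _))// ler_wpM2l// quotient_proj_contract.
have fP : (g \o quotient_proj) \in lip_pred N.
  by apply/asboolP; split=> [|x Nx /=]; [exists k|rewrite quotient_proj_base].
exists (LipFun (ex_intro N x0 Nx0) fP); split=> [p|].
  by rewrite /= quotient_projK.
exact: lip_const_le.
Qed.

End QuotientLip.

(** * The isometry from the free space to the dual of the Lipschitz functions *)

Section ClosedRange.
Context {R : realType} {F : completeNormedModType R} {E : normedModType R}.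
Context (T : {linear F -> E}) (Tiso : forall v, `|T v| = `|v|).

(** Approximating images converge, so they are Cauchy; the isometry transfers
    this to their preimages, whose limit is mapped to [phi]. *)
Lemma closure_range_isometry (phi : E) :
  (forall e : R, 0 < e -> exists v, `|phi - T v| < e) -> range T phi.
Proof.
move=> h.
have /choice[u uP] : forall n : nat, exists v, `|phi - T v| < n.+1%:R^-1.
  by move=> n; apply: h; rewrite invr_gt0.
have tail (e : R) : 0 < e -> exists N : nat, forall n, (N <= n)%N -> `|phi - T (u n)| < e.
  move=> e0; have [N _ hN] := near_infty_natSinv_lt (PosNum e0).
  by exists N => n Nn; rewrite (lt_trans (uP n))//; exact: (hN n Nn).
have uC : cauchy (u @ \oo).
  apply: cauchy_exP => e e0; have [N hN] := tail _ (divr_gt0 e0 (ltr0Sn R 1)).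
  exists (u N); exists N => // n /= Nn; rewrite -ball_normE /= -Tiso linearB.
  have -> : T (u N) - T (u n) = (phi - T (u n)) - (phi - T (u N)).
    by rewrite opprB [RHS]addrC addrA subrK.
  by rewrite (le_lt_trans (ler_normB _ _))// (splitr e) ltrD// hN.
have /cvg_ex[/= v uv] : cvg (u @ \oo) by exact: cauchy_cvg.
exists v => //; apply/eqP; rewrite eq_sym -subr_eq0 -normr_le0.
apply/ler_addgt0Pr => e e0; rewrite add0r.
have [N hN] := tail _ (divr_gt0 e0 (ltr0Sn R 1)).
have /cvgrPdist_lt/(_ _ (divr_gt0 e0 (ltr0Sn R 1))) [K _ hK] := uv.
have := hK (maxn N K) (leq_maxr _ _); rewrite /= -Tiso linearB => h1.
have h2 := hN (maxn N K) (leq_maxl _ _).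
rewrite -(subrK (T (u (maxn N K))) phi) -addrA (le_trans (ler_normD _ _))//.
by rewrite (splitr e) lerD// ltW// distrC.
Qed.

End ClosedRange.

Section FreeToDual.
Context {R : realType} {M : metricType R} {N : set M} {x0 : M}.
Context {cN : closed N} {Nx0 : N x0}.
Local Notation Q := (quotient_space cN Nx0).
Local Notation base := (quotient_base cN Nx0).
Local Notation L := (lip_space (ex_intro N x0 Nx0)).
Context {F : completeNormedModType R} {delta : Q -> F}.
Context (free : is_lipschitz_free base delta).

Lemma lip_space_extension (f : L) : exists T : {linear F -> R^o},
  (forall p, T (delta p) = f (val p)) /\ forall v, `|T v| <= `|f| * `|v|.
Proof.
have [fQ f0 fk] := lip_space_on_quotient cN Nx0 f.
have [T [Tf Tk]] := free_scalar_extension free _ fQ f0.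
by exists T; split=> // v; rewrite (le_trans (Tk v))// ler_wpM2r.
Qed.

Definition extend (f : L) : {linear F -> R^o} := projT1 (cid (lip_space_extension f)).

Lemma extend_delta f p : extend f (delta p) = f (val p).
Proof. by rewrite /extend; case: cid => T []. Qed.

Lemma extend_le f v : `|extend f v| <= `|f| * `|v|.
Proof. by rewrite /extend; case: cid => T []. Qed.

Lemma extend_unique (f : L) (T : {linear F -> R^o}) : continuous T ->
  (forall p, T (delta p) = f (val p)) -> extend f =1 T.
Proof.
move=> cT Tf; apply: (free_scalar_unique free) => // [|p].
  exact: linear_continuous_of_bound (extend_le f).
by rewrite extend_delta Tf.
Qed.

(** Linearity in [f] comes from uniqueness: [a *: extend f + extend g] extends
    [a *: f + g]. *)
Lemma extend_linear (v : F) : linear (fun f : L => extend f v : R^o).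
Proof.
move=> a f g.
rewrite (extend_unique _ (a \*: extend f \+ extend g : {linear F -> R^o})) => [//||p].
  apply: (linear_continuous_of_bound _ (`|a| * `|f| + `|g|)) => w /=.
  rewrite (le_trans (ler_normD _ _))// mulrDl lerD//; last exact: extend_le.
  by rewrite normrZ -mulrA ler_wpM2l// extend_le.
by rewrite /= !extend_delta.
Qed.

Lemma functional_subproof (v : F) :
  (fun f : L => extend f v : R^o) \in @dual_pred R L.
Proof.
apply/asboolP; split; first exact: extend_linear.
pose g : {linear L -> R^o} := HB.pack (fun f : L => extend f v : R^o)
  (GRing.isLinear.Build R L R^o *:%R _ (extend_linear v)).
apply: (linear_continuous_of_bound g `|v|) => f.
by rewrite mulrC; exact: extend_le.
Qed.

Definition functional (v : F) : dual L := DualFun (functional_subproof v).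

Lemma functional_linear : linear functional.
Proof.
by move=> a u v; apply/val_inj/funext => f /=; rewrite linearP.
Qed.

HB.instance Definition _ :=
  GRing.isLinear.Build R F (dual L) *:%R functional functional_linear.

Lemma dual_norm_le (phi : dual L) (k : R) : 0 <= k ->
  (forall f, `|phi f| <= k * `|f|) -> `|phi| <= k.
Proof. exact: (@op_norm_le R L R^o phi). Qed.

Lemma dual_norm_ge (phi : dual L) f : `|phi f| <= `|phi| * `|f|.
Proof. exact: (@op_norm_ge R L R^o phi f (@dual_continuous R L phi)). Qed.

(** For the lower bound, a norming form [phi] of [v] pulled back along [delta]
    is a 1-Lipschitz function on the quotient; its extension [f] by zero lies in
    the unit ball of [L] and [extend f = phi]. *)
Lemma functional_isometry v : `|functional v| = `|v|.
Proof.
apply/eqP; rewrite eq_le; apply/andP; split.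
  by apply: dual_norm_le => // f; rewrite mulrC; exact: extend_le.
have [phi [phi_le phiv]] := norming_functional v.
have phi1 w : `|phi w| <= 1 * `|w| by rewrite mul1r.
have [||f [fphi f1]] :=
    lip_space_of_quotient cN Nx0 (fun p => phi (delta p)) 1 ler01.
- exact: (delta_comp_lipschitz free phi 1 phi1).
- by rewrite (free_base free) linear0.
have <- : functional v f = `|v|.
  rewrite /= (extend_unique _ phi)//.
  exact: linear_continuous_of_bound phi1.
rewrite (le_trans (ler_norm _))// (le_trans (dual_norm_ge _ _))//.
by rewrite ler_piMr.
Qed.

End FreeToDual.

(** * Integrals against finite Borel measures and charges *)

Section Borel.
Context {R : realType} {d : nat}.
Implicit Types A : set (euclid R d).

Lemma borel_open A : open A -> measurable (A : set (borel R d)).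
Proof. by move=> oA; exact: sub_sigma_algebra. Qed.

Lemma borel_closed A : closed A -> measurable (A : set (borel R d)).
Proof.
move=> cA; rewrite -[A]setCK; apply: measurableC; apply: borel_open.
exact: closed_openC.
Qed.

Lemma borel_compact A : compact A -> measurable (A : set (borel R d)).
Proof.
by move=> kA; apply: borel_closed; apply: compact_closed => //; exact: metric_hausdorff.
Qed.

Lemma borel_finite A : finite_set A -> measurable (A : set (borel R d)).
Proof. by move=> fA; apply: borel_compact; exact: finite_compact. Qed.

Lemma euclid_mdist (x y : euclid R d) : mdist x y = `|x - y|.
Proof. by []. Qed.

Lemma lipschitz_continuous (f : euclid R d -> R^o) : lipschitz_map f -> continuous f.
Proof.
move=> fL x; apply/(@cvgrPdist_lt _ _ _ (nbhs x)) => e e0.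
have k0 := lip_const_ge0 fL; set k := lip_const f in k0.
have k1 : 0 < k + 1 by rewrite ltr_wpDl.
apply/nbhs_ballP; exists (e / (k + 1)); first by rewrite /= divr_gt0.
move=> y; rewrite -ball_normE /= => xy.
rewrite (le_lt_trans (lip_constP x y fL))// -/k euclid_mdist.
rewrite (@le_lt_trans _ _ ((k + 1) * `|x - y|))//.
  by rewrite ler_wpM2r// lerDl.
by rewrite mulrC -ltr_pdivlMr.
Qed.

Lemma continuous_borel (f : euclid R d -> R^o) (D : set (borel R d)) :
  continuous f -> measurable D -> measurable_fun D (f : borel R d -> R).
Proof.
move=> /continuousP fc mD.
apply: (measurability _ (RGenOInfty.measurableE R)) => _ [_ [a ->] <-].
by apply: measurableI => //; apply: borel_open; apply: fc; exact: interval_open.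
Qed.

End Borel.

Section ChargeIntegral.
Context {R : realType} {d : nat}.
Local Notation measureT := {finite_measure set (borel R d) -> \bar R}.

Section Add.
Context (m1 m2 : measureT).

Let fin_num_add : fin_num_fun (measure_add m1 m2).
Proof. by move=> A mA; rewrite measure_addE fin_numD !fin_num_measure. Qed.

HB.instance Definition _ := Measure.copy (measure_add m1 m2)
  (msum (fun n => if n is 0%N then m1 : {measure set _ -> \bar R} else m2) 2).

HB.instance Definition _ :=
  Measure_isFinite.Build _ _ _ (measure_add m1 m2) fin_num_add.
End Add.

Lemma Rintegral_measure_add (m1 m2 : measureT) (D : set (borel R d)) (f : borel R d -> R) :
  measurable D -> measurable_fun D f -> [bounded f x | x in D] ->
  \int[measure_add m1 m2]_(x in D) f x =
  \int[m1]_(x in D) f x + \int[m2]_(x in D) f x.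
Proof.
move=> mD mf bf.
have fi (m : measureT) : m.-integrable D (EFin \o f).
  by apply: measurable_bounded_integrable => //; rewrite -ge0_fin_numE ?fin_num_measure.
rewrite /Rintegral integral_measure_add//; try exact: fi.
by rewrite fineD//; apply: integrable_fin_num => //; exact: fi.
Qed.

Lemma eq_Rintegral_measure (m1 m2 : measureT) (D : set (borel R d)) (f : borel R d -> R) :
  (forall A, measurable A -> m1 A = m2 A) ->
  \int[m1]_(x in D) f x = \int[m2]_(x in D) f x.
Proof.
by move=> m12; congr fine; apply: eq_measure_integral => A mA _; exact: m12.
Qed.

(** The integral against a charge may be computed from any decomposition as a
    difference of finite measures: if [nu = P - N = m1 - m2], then
    [P + m2 = m1 + N] as measures. *)
Lemma charge_integralE (nu : {charge set (borel R d) -> \bar R}) (m1 m2 : measureT)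
    (D : set (borel R d)) (f : borel R d -> R) :
  (forall A, measurable A -> nu A = (m1 A - m2 A)%E) ->
  measurable D -> measurable_fun D f -> [bounded f x | x in D] ->
  charge_integral nu D f = \int[m1]_(x in D) f x - \int[m2]_(x in D) f x.
Proof.
move=> nuE mD mf bf; rewrite /charge_integral.
set P : measureT := positive_part nu; set N : measureT := negative_part nu.
apply/eqP; rewrite subr_eq addrAC eq_sym subr_eq eq_sym.
rewrite -!Rintegral_measure_add//; apply/eqP; apply: eq_Rintegral_measure => A mA.
transitivity (P A + m2 A)%E; first exact: measure_addE.
transitivity (m1 A + N A)%E; last exact/esym/measure_addE.
have := jordan_decomp (svalP (hahn_pair nu)) mA.
rewrite /cadd/= cscaleN1 nuE// => h.
have {}h : (m1 A - m2 A = P A - N A)%E := h.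
rewrite -[m1 A](@subeK _ _ (m2 A)) ?fin_num_measure// h.
by rewrite addeAC subeK// fin_num_measure.
Qed.

End ChargeIntegral.

(** * Total boundedness of bounded sets *)

Section TotallyBounded.
Context {R : realType} {d : nat}.

Lemma euclid_norm_le (x : euclid R d) (e : R) : 0 <= e ->
  (forall i, `|(x : 'rV[R]_d) ord0 i| <= e) -> `|x| <= Num.sqrt d%:R * e.
Proof.
move=> e0 xe; have -> : `|x| = euclid_norm x by [].
rewrite -[X in _ * X]ger0_norm// -sqrtr_sqr -sqrtrM// ler_wsqrtr//.
rewrite mulr_natl -[d in X in _ <= X]card_ord -sumr_const ler_sum// => i _.
by rewrite -real_normK ?num_real// lerXn2r ?nnegrE.
Qed.

Lemma coord_le_euclid_norm (x : euclid R d) i : `|(x : 'rV[R]_d) ord0 i| <= `|x|.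
Proof.
have -> : `|x| = euclid_norm x by [].
rewrite -sqrtr_sqr ler_wsqrtr// (bigD1 i)//= lerDl.
by apply: sumr_ge0 => j _; exact: sqr_ge0.
Qed.

Lemma rV_euclid_continuous : continuous (id : 'rV[R]_d -> euclid R d).
Proof.
move=> x A /nbhs_ballP[e /= e0 eA]; pose s : R := Num.sqrt d%:R + 1.
have s0 : 0 < s by rewrite ltr_wpDl ?sqrtr_ge0.
apply/nbhs_ballP; exists (e / s); first by rewrite /= divr_gt0.
move=> y [_ xy]; apply: eA; rewrite -ball_normE /=.
rewrite (@le_lt_trans _ _ (Num.sqrt d%:R * (e / s)))//.
  apply: euclid_norm_le => [|i]; first by rewrite ltW// divr_gt0.
  have -> : (x - y : euclid R d) = (x : 'rV[R]_d) - y by [].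
  by rewrite !mxE ltW//; have := xy ord0 i; rewrite -ball_normE.
by rewrite mulrCA gtr_pMr// ltr_pdivrMr// mul1r ltrDl.
Qed.

(** The compactness of cubes is known for the maximum norm and transported along
    the identity map, which is continuous towards the Euclidean norm. *)
Lemma euclid_totally_bounded (U : set (euclid R d)) (e : R) :
  bounded_set U -> 0 < e ->
  exists s : seq (euclid R d), forall x, U x -> exists2 c, c \in s & ball c e x.
Proof.
move=> [k [_ kU]] e0.
pose K := [set v : 'rV[R]_d | forall i, `[- (k + 1), k + 1]%classic (v ord0 i)].
pose j (v : 'rV[R]_d) : euclid R d := v.
have KK : compact (j @` K).
  apply: (@continuous_compact _ _ j).
    by apply: continuous_subspaceT; exact: rV_euclid_continuous.
  have := @rV_compact R d (fun=> `[- (k + 1), k + 1]%classic) (fun=> @segment_compact R _ _).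
  by apply.
have := KK; rewrite compact_cover => /(_ (euclid R d) setT (fun c => ball c e)).
case=> [c _|v _|s _ sK].
- exact: ball_open.
- by exists v => //; exact: ballxx.
- exists (finmap.enum_fset s) => x Ux.
  have [|c /= cs cx] := sK x; last by exists c.
  exists x => // i /=; rewrite in_itv/= -ler_norml.
  rewrite (le_trans (coord_le_euclid_norm x i))//.
  by apply: (kU (k + 1)); rewrite ?ltrDl.
Qed.
End TotallyBounded.

(** * Finitely supported measures *)

Section LipMeasurable.
Context {R : realType} {d : nat} {U : set (euclid R d)}.
Context (oU : open U) (bU : bounded_set U) {x0 : euclid R d} (Ux0 : (~` U) x0).
Local Notation L := (lip_space (ex_intro (~` U) x0 Ux0)).
Local Notation measureT := {finite_measure set (borel R d) -> \bar R}.

Lemma lip_space_measurable (f : L) (D : set (borel R d)) :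
  measurable D -> measurable_fun D (f : borel R d -> R).
Proof.
move=> mD; apply: continuous_borel => //; apply: lipschitz_continuous.
exact: lip_space_lipschitz.
Qed.

Lemma lip_space_bounded (f : L) (D : set (borel R d)) : D `<=` U ->
  [bounded (f : borel R d -> R) x | x in D].
Proof.
move=> DU; have [k [_ kU]] := bU.
exists (`|f| * (k + 1 + `|x0|)); split; first exact: num_real.
move=> M kM x Dx; apply: ltW; apply: le_lt_trans kM.
have -> : f x = f x - f x0 by rewrite (lip_space_eq0 f Ux0) subr0.
rewrite (le_trans (lip_norm_dist _ _ _ _))// ler_wpM2l// euclid_mdist.
rewrite (le_trans (ler_normB _ _))// lerD2r.
by apply: (kU (k + 1)); rewrite ?ltrDl//; exact: DU.
Qed.

Lemma lip_space_integrable (mu : measureT) (f : L) (D : set (borel R d)) :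
  measurable D -> D `<=` U -> mu.-integrable D (EFin \o (f : borel R d -> R)).
Proof.
move=> mD DU; apply: measurable_bounded_integrable => //.
- by rewrite -ge0_fin_numE ?fin_num_measure.
- exact: lip_space_measurable.
- exact: lip_space_bounded.
Qed.

Lemma Rintegral_mscale (mu : measureT) (k : {nonneg R}) (D : set (borel R d))
    (f : borel R d -> R) : measurable D -> mu.-integrable D (EFin \o f) ->
  \int[mscale k mu]_(x in D) f x = k%:num * \int[mu]_(x in D) f x.
Proof.
move=> mD fi; have mf := measurable_int _ fi.
rewrite /Rintegral integralE ge0_integral_mscale//; last exact: measurable_funepos.
rewrite ge0_integral_mscale//; last exact: measurable_funeneg.
rewrite -muleBr//; last first.
  by rewrite fin_num_adde_defl// fin_numN integrable_neg_fin_num.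
by rewrite -integralE fineM// integrable_fin_num.
Qed.

Definition finitely_supported (mu : measureT) :=
  exists B : set (euclid R d), [/\ finite_set B, B `<=` U & mu (~` B) = 0%E].

Lemma finitely_supported_dirac (x : borel R d) : U x ->
  finitely_supported (\d_x : measureT).
Proof.
move=> Ux; exists [set x]; split=> [|_ ->//|]; first exact: finite_set1.
by rewrite /= diracE memNset //= => /(_ erefl).
Qed.

Lemma finitely_supported_mscale (mu : measureT) (k : {nonneg R}) :
  finitely_supported mu -> finitely_supported (mscale k mu).
Proof.
move=> [B [fB BU mu0]]; exists B; split=> //.
by transitivity (k%:num%:E * mu (~` B))%E => //; rewrite mu0 mule0.
Qed.

Lemma null_off (mu : measureT) (B : set (euclid R d)) (A : set (borel R d)) :
  finite_set B -> mu (~` B) = 0%E -> measurable A -> A `<=` ~` B -> mu A = 0%E.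
Proof.
move=> fB mu0 mA AB; apply: subset_measure0 mA _ AB mu0.
by apply: measurableC; exact: borel_finite.
Qed.

Lemma finitely_supported_add (mu mu' : measureT) : finitely_supported mu ->
  finitely_supported mu' -> finitely_supported (measure_add mu mu').
Proof.
move=> [B [fB BU mu0]] [B' [fB' BU' mu0']].
have fBB : finite_set (B `|` B') by rewrite finite_setU.
have mBB : measurable (~` (B `|` B') : set (borel R d)).
  by apply: measurableC; exact: borel_finite.
exists (B `|` B'); split; [exact: fBB|by rewrite subUset|].
transitivity (mu (~` (B `|` B')) + mu' (~` (B `|` B')))%E; first exact: measure_addE.
have -> : mu (~` (B `|` B')) = 0%E.
  by apply: (null_off _ _ _ fB) => //; apply: subsetC; exact: subsetUl.
have -> : mu' (~` (B `|` B')) = 0%E.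
  by apply: (null_off _ _ _ fB') => //; apply: subsetC; exact: subsetUr.
exact: adde0.
Qed.

(** The total variation of a difference of finitely supported measures is
    carried by a finite set [B], so it takes the same value on [A] and on the
    compact set [A `&` B]: inner regularity is immediate. *)
Lemma finitely_supported_functional (m1 m2 : measureT) (phi : dual L) :
  finitely_supported m1 -> finitely_supported m2 ->
  (forall f, phi f = \int[m1]_(x in U) (f : borel R d -> R) x
                   - \int[m2]_(x in U) (f : borel R d -> R) x) ->
  measure_functionals (ex_intro (~` U) x0 Ux0) phi.
Proof.
move=> [B1 [fB1 B1U m10]] [B2 [fB2 B2U m20]] phiE.
pose B := B1 `|` B2.
have fB : finite_set B by rewrite finite_setU.
have BU : B `<=` U by rewrite subUset.
pose nu : {charge set (borel R d) -> \bar R} :=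
  cadd (charge_of_finite_measure m1) (copp (charge_of_finite_measure m2)).
have nuE A : nu A = (m1 A - m2 A)%E by [].
have nu0 (A : set (borel R d)) : measurable A -> A `<=` ~` B -> nu A = 0%E.
  move=> mA AB; rewrite nuE.
  have -> : m1 A = 0%E.
    apply: (null_off _ _ _ fB1) => //; apply: (subset_trans AB).
    by apply: subsetC; exact: subsetUl.
  have -> : m2 A = 0%E.
    apply: (null_off _ _ _ fB2) => //; apply: (subset_trans AB).
    by apply: subsetC; exact: subsetUr.
  exact: sube0.
exists nu; split; last first.
  move=> f; rewrite phiE; apply/esym; apply: charge_integralE => //.
  - exact: borel_open.
  - by apply: lip_space_measurable; exact: borel_open.
  - exact: lip_space_bounded.
split=> [A mA AU|A mA AU].
  by apply: nu0 => // x Ax Bx; exact: AU Ax (BU _ Bx).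
pose tv : {measure set (borel R d) -> \bar R} :=
  charge_variation (svalP (hahn_pair nu)).
have tv0 (C : set (borel R d)) : measurable C -> C `<=` ~` B -> tv C = 0%E.
  move=> mC CB; have [[mP _] [mN _] _ _] := svalP (hahn_pair nu).
  have nuI (P : set (borel R d)) : measurable P -> nu (C `&` P) = 0%E.
    move=> mP'; apply: nu0; first exact: measurableI.
    by move=> x [Cx _]; exact: CB.
  transitivity (nu (C `&` (sval (hahn_pair nu)).1) -
                nu (C `&` (sval (hahn_pair nu)).2))%E.
    rewrite /tv /= /charge_variation /=.
    rewrite jordan_posE jordan_negE cjordan_posE cjordan_negE /crestr0 mem_set//.
  by rewrite !nuI// sube0.
have fAB : finite_set (A `&` B) by apply: sub_finite_set fB; exact: subIsetr.
have mAB : measurable (A `&` B : set (borel R d)) by exact: borel_finite.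
have mADB : measurable (A `\` B : set (borel R d)).
  by apply: measurableD => //; exact: borel_finite.
rewrite -[Defs.total_variation nu]/(tv : set _ -> _).
apply/eqP; rewrite eq_le; apply/andP; split.
  apply: ereal_sup_ubound; exists (A `&` B).
    by split; [exact: finite_compact|exact: subIsetl].
  transitivity (tv ((A `&` B) `|` (A `\` B))); last by rewrite setUIDK.
  rewrite measureU//; last by rewrite setDE setIACA setICr setI0.
  by rewrite [X in _ = (_ + X)%E]tv0 ?adde0// => x [].
apply: ge_ereal_sup => _ [K [kK KA] <-].
apply: le_measure; rewrite ?inE//; exact: borel_compact.
Qed.

End LipMeasurable.

(** * The range of the isometry *)

Section Assembly.
Context {R : realType} {d : nat} {U : set (euclid R d)}.
Context (oU : open U) (bU : bounded_set U) {x0 : euclid R d} {Ux0 : (~` U) x0}.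
Local Notation Q := (quotient_space (open_closedC oU) Ux0).
Local Notation base := (quotient_base (open_closedC oU) Ux0).
Local Notation L := (lip_space (ex_intro (~` U) x0 Ux0)).
Local Notation measureT := {finite_measure set (borel R d) -> \bar R}.
Context {F : completeNormedModType R} {delta : Q -> F}.
Context (free : is_lipschitz_free base delta).
Local Notation lint mu A f := (\int[mu]_(x in A) (f : borel R d -> R) x).

Let mU : measurable (U : set (borel R d)).
Proof. exact: borel_open. Qed.

(** A pair of positive measures replaces a charge so that the Jordan
    decomposition, which does not depend linearly on the charge, is only needed
    once. *)
Definition discrete (v : F) := exists m1 m2 : measureT,
  [/\ finitely_supported (U := U) m1, finitely_supported (U := U) m2 &
      forall f : L, extend free f v = lint m1 U f - lint m2 U f].

Lemma discrete0 : discrete 0.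
Proof.
pose m : measureT := mscale (NngNum (lexx (0 : R))) (\d_(x0 : borel R d) : measureT).
have fm : finitely_supported (U := U) m.
  by exists set0; split; [exact: finite_set0|exact: sub0set|exact: mul0e].
by exists m, m; split=> // f; rewrite linear0 subrr.
Qed.

Lemma discrete_opp v : discrete v -> discrete (- v).
Proof.
by move=> [m1 [m2 [f1 f2 vE]]]; exists m2, m1; split=> // f; rewrite linearN vE opprB.
Qed.

Lemma discrete_scale_ge0 (a : R) v : 0 <= a -> discrete v -> discrete (a *: v).
Proof.
move=> a0 [m1 [m2 [f1 f2 vE]]].
exists (mscale (NngNum a0) m1), (mscale (NngNum a0) m2).
split=> [||f]; [exact: finitely_supported_mscale..|].
rewrite linearZ vE !Rintegral_mscale//; first exact: mulrBr.
all: exact: (lip_space_integrable bU).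
Qed.

Lemma discrete_add u v : discrete u -> discrete v -> discrete (u + v).
Proof.
move=> [m1 [m2 [f1 f2 uE]]] [n1 [n2 [g1 g2 vE]]].
exists (measure_add m1 n1), (measure_add m2 n2).
split=> [||f]; [exact: finitely_supported_add..|].
rewrite linearD uE vE !Rintegral_measure_add//; first by rewrite opprD addrACA.
all: by [exact: lip_space_measurable|exact: (lip_space_bounded bU)].
Qed.

Lemma discrete_scale (a : R) v : discrete v -> discrete (a *: v).
Proof.
move=> dv; have [a0|a0] := leP 0 a; first exact: discrete_scale_ge0.
rewrite -[a]opprK scaleNr; apply: discrete_opp; apply: discrete_scale_ge0 => //.
by rewrite oppr_ge0 ltW.
Qed.

Lemma discrete_delta p : discrete (delta p).
Proof.
have [Up|Up] := pselect (U (val p)); last first.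
  have -> : p = base.
    apply: val_inj; have := valP p.
    by rewrite inE => -[nnU|//]; case: Up; exact: contrapT.
  by rewrite (free_base free); exact: discrete0.
have [_ [m2 [_ f2 _]]] := discrete0.
pose z : measureT := mscale (NngNum (lexx (0 : R))) m2.
exists (\d_(val p : borel R d) : measureT), z; split=> [||f].
- exact: finitely_supported_dirac.
- exact: finitely_supported_mscale.
- rewrite extend_delta Rintegral_mscale//; last exact: (lip_space_integrable bU).
  rewrite mul0r subr0 /Rintegral integral_dirac//; last first.
    by apply/measurable_EFinP; exact: lip_space_measurable.
  by rewrite diracE mem_set// mul1e.
Qed.

Lemma discrete_functional v : discrete v ->
  measure_functionals (ex_intro (~` U) x0 Ux0) (functional free v).
Proof.
move=> [m1 [m2 [f1 f2 vE]]].
exact: (finitely_supported_functional oU bU Ux0 m1 m2).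
Qed.

Lemma functional_closure v :
  closure (measure_functionals (ex_intro (~` U) x0 Ux0)) (functional free v).
Proof.
move=> B /nbhs_ballP[e /= e0 eB].
have [s ds vs] : exists2 s, discrete s & `|v - s| < e.
  apply: (free_span_dense free) => //; first exact: discrete0.
    by move=> a u w du dw; apply: discrete_add => //; exact: discrete_scale.
  exact: discrete_delta.
exists (functional free s); split; first exact: discrete_functional.
by apply: eB; rewrite -ball_normE /= -linearB functional_isometry.
Qed.

(** The pieces of the partition are split off one ball at a time.  On the piece
    [A1] inside the first ball, [f] differs from its value at a point of [A1] by
    at most [2 * e * `|f|], the ball having diameter at most [2 * e]. *)
Lemma measure_approximation (mu : measureT) (e : R) (s : seq (euclid R d))
    (A : set (borel R d)) : 0 < e ->
  measurable A -> A `<=` U -> (forall x, A x -> exists2 c, c \in s & ball c e x) ->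
  exists v, forall f : L,
    `|lint mu A f - extend free f v| <= 2 * e * `|f| * fine (mu A).
Proof.
move=> e0; elim: s A => [|c s IH] A mA AU As.
  have -> : A = set0 by rewrite -subset0 => x /As[].
  by exists 0 => f; rewrite Rintegral_set0 linear0 subrr normr0 measure0 mulr0.
have mc : measurable (ball c e : set (borel R d)) by apply: borel_open; exact: ball_open.
have [|||v2 v2P] := IH (A `\` ball c e).
- exact: measurableD.
- by move=> x [/AU].
- move=> x [Ax cx]; have [c' + c'x] := As x Ax.
  by rewrite inE => /orP[/eqP cc'|]; [rewrite cc' in c'x|exists c'].
pose A1 := A `&` ball c e.
have mA1 : measurable (A1 : set (borel R d)) by exact: measurableI.
have mA2 : measurable (A `\` ball c e : set (borel R d)) by exact: measurableD.
have A1U : A1 `<=` U by move=> x [/AU].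
have intU (f : L) : lint mu A f = lint mu A1 f + lint mu (A `\` ball c e) f.
  rewrite -Rintegral_setU// ?setUIDK//; first exact: (lip_space_integrable bU).
  by apply/disj_setPS => x [[_ ?] []].
have muU : fine (mu A) = fine (mu A1) + fine (mu (A `\` ball c e)).
  rewrite -fineD ?fin_num_measure// -measureU//; first by rewrite setUIDK.
  by rewrite setDE setIACA setICr setI0.
have [v1 v1P] : exists v1, forall f : L,
    `|lint mu A1 f - extend free f v1| <= 2 * e * `|f| * fine (mu A1).
  have [->|/set0P[a [Aa ca]]] := eqVneq A1 set0.
    by exists 0 => f; rewrite Rintegral_set0 linear0 subrr normr0 measure0 mulr0.
  pose p : Q := quotient_proj (open_closedC oU) Ux0 a.
  have va : val p = a by apply: val_quotient_proj => /(_ (AU _ Aa)).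
  exists (fine (mu A1) *: delta p) => f.
  rewrite linearZ/= extend_delta va.
  have fi := lip_space_integrable bU Ux0 mu f A1 mA1 A1U.
  have ci (k : R) : mu.-integrable A1 (EFin \o cst k).
    by apply: finite_measure_integrable_cst.
  have -> : fine (mu A1) *: (f a : R^o) = \int[mu]_(x in A1) f a.
    by rewrite Rintegral_cst// mulrC.
  rewrite -RintegralB//; last exact: ci.
  have fci : mu.-integrable A1 (EFin \o (fun x : borel R d => f x - f a)).
    by rewrite (_ : _ \o _ = ((EFin \o f) \- (EFin \o cst (f a)))%E)//; exact: integrableB.
  rewrite (le_trans (le_normr_Rintegral mA1 fci))//.
  rewrite -Rintegral_cst//; apply: le_Rintegral => //; [exact: (integrable_norm fci)|exact: ci|].
  move=> x [Ax cx]; rewrite (le_trans (lip_norm_dist _ _ _ _))// mulrC ler_wpM2r//.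
  rewrite mulr_natl mulr2n ltW// (le_lt_trans (metric_triangle _ c _))// ltrD//.
    by rewrite metric_sym; move: cx; rewrite ballEmdist.
exists (v1 + v2) => f; rewrite intU muU linearD mulrDr opprD addrACA.
by rewrite (le_trans (ler_normD _ _))// lerD.
Qed.

Lemma measure_functional_approx (phi : dual L) (e : R) :
  measure_functionals (ex_intro (~` U) x0 Ux0) phi -> 0 < e ->
  exists v, `|phi - functional free v| < e.
Proof.
move=> [nu [_ phiE]] e0.
set P : measureT := positive_part nu; set N : measureT := negative_part nu.
pose C := fine (P U) + fine (N U).
have C0 : 0 <= C by rewrite addr_ge0// fine_ge0.
have C1 : 0 < C + 1 by rewrite ltr_wpDl.
(* The mass [C] may be zero, hence [C + 1]. *)
pose e' := e / (2 * (C + 1)).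
have e'0 : 0 < e' by rewrite divr_gt0// mulr_gt0.
have [s Us] := euclid_totally_bounded U e' bU e'0.
have [v1 v1P] := measure_approximation P e' s U e'0 mU (@subset_refl _ _) Us.
have [v2 v2P] := measure_approximation N e' s U e'0 mU (@subset_refl _ _) Us.
exists (v1 - v2).
apply: (@le_lt_trans _ _ (2 * e' * C)).
  apply: dual_norm_le => [|f]; first by rewrite mulr_ge0// mulr_ge0// ltW.
  have -> : (phi - functional free (v1 - v2)) f = phi f - extend free f (v1 - v2) by [].
  rewrite phiE /charge_integral -/P -/N.
  have -> : lint P U f - lint N U f - extend free f (v1 - v2) =
      (lint P U f - extend free f v1) - (lint N U f - extend free f v2).
    by rewrite linearB !opprB addrACA [RHS]addrACA; congr (_ + _); exact: addrC.
  by rewrite mulrAC /C mulrDr (le_trans (ler_normB _ _))// lerD.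
have -> : 2 * e' * C = e * (C / (C + 1)).
  by rewrite /e'; field; rewrite gt_eqF.
by rewrite gtr_pMr// ltr_pdivrMr// mul1r ltrDl.
Qed.

Lemma closure_functional phi :
  closure (measure_functionals (ex_intro (~` U) x0 Ux0)) phi ->
  range (functional free) phi.
Proof.
move=> phicl; apply: closure_range_isometry => [|e e0].
  exact: functional_isometry.
have e20 : 0 < e / 2 by rewrite divr_gt0.
have [psi [Wpsi]] := phicl _ (nbhsx_ballx phi _ e20).
rewrite -ball_normE /= => phipsi.
have [v vpsi] := measure_functional_approx psi _ Wpsi e20.
exists v; rewrite -(subrK psi phi) -addrA (le_lt_trans (ler_normD _ _))//.
by rewrite (splitr e) ltrD.
Qed.

End Assembly.

Theorem theorem1p11 (R : realType) (d : nat) (U : set (euclid R d))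
    (oU : open U) (bU : bounded_set U) (x0 : euclid R d) (Ux0 : (~` U) x0)
    (F : completeNormedModType R)
    (delta : quotient_space (open_closedC oU) Ux0 -> F) :
  is_lipschitz_free (quotient_base (open_closedC oU) Ux0) delta ->
  linearly_isometric F (sobolev_neg1_1 (ex_intro (~` U) x0 Ux0)).
Proof.
move=> free; exists (functional free : {linear F -> _}); split.
  exact: functional_isometry.
apply/seteqP; split=> [_ [v _ <-]|phi].
  exact: (functional_closure oU bU free).
exact: (closure_functional oU bU free).
Qed.
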